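(* Let $R$ be a finite commutative chain ring of depth $r\ge 2$ with residue field $\mathbb{F}_q$, let $\Omega\subseteq \overline{R^k}$ be stable under multiplication by $R^\times$ and generate $R^k$, and let $C(\Omega)$ be the associated code. Assume that $C(\Omega)^\bot$, of length $n$, has exactly three nonzero homogeneous weights $w_1<w_2<w_3$. Let $b$ be any non-negative integer. Then: \begin{itemize} \item $\Omega$ is a triple sum set if and only if $w_1+w_2+w_3=3n(q-1)q^{r-2}$; \item $\Omega\cup\{0\}$ is a triple sum set if and only if $w_1+w_2+w_3=3\,\frac{1+n(q-1)q^{r-1}}{q}$; \item $\Gamma_{C(\Omega)}^b$ is a $3$-SWRG if and only if $w_1+w_2+w_3=3\,\frac{b+n(q-1)q^{r-1}}{q}$. \end{itemize}
   Context: A finite chain ring of depth $r$ is a finite local ring whose ideals form a chain; its maximal ideal is principal, generated by an element $\gamma$ of nilpotency index $r$. Homogeneous weight on $R$: $\mathrm{w}_{\mathrm{hom}}(0)=0$, $\mathrm{w}_{\mathrm{hom}}(x)=q^{r-1}$ if $0\ne x\in(\gamma^{r-1})$, and $\mathrm{w}_{\mathrm{hom}}(x)=(q-1)q^{r-2}$ otherwise; it is extended additively to $R^n$. The homogeneous weights of a linear code are the weights of its nonzero codewords. The dual code is taken with respect to the standard inner product. $\overline{R^k}=\{\omega\in R^k : \{\omega\cdot x : x\in R^k\}=R\}$ is the set of regular vectors. For $\Omega\subseteq\overline{R^k}$ stable under multiplication by units, let $H$ be the $k\times n$ matrix whose columns form a system of representatives of $\Omega$ modulo multiplication by $R^\times$,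 so $n=|\Omega|/|R^\times|$. Then $C(\Omega)=\{x\in R^n: Hx=0\}$, and $C(\Omega)^\bot$ is the linear code generated by the rows of $H$. $\Gamma_{C(\Omega)}$ is the syndrome (coset) graph of $C(\Omega)$: its vertices are the syndromes $Hx$, $x\in R^n$, and two vertices are adjacent iff they differ by a unit multiple of a column of $H$. Since $\Omega$ generates $R^k$, it is the Cayley graph on $(R^k,+)$ with connection set $\Omega$. $\Gamma_{C(\Omega)}^b$ is obtained from it by adding $b$ loops at every vertex. A set $\Omega'\subseteq R^k$ is a triple sum set if it is stable under multiplication by units of $R$ and there are integer constants $\sigma_0,\sigma_1$ such that every nonzero $h\in R^k$ can be written as $h=x+y+z$ with $(x,y,z)\in\Omega'^3$ in exactly $\sigma_0$ ways if $h\in\Omega'$ and in exactly $\sigma_1$ ways if $h\notin\Omega'$. A graph (possibly with loops) is a $3$-SWRG (strongly walk-regular graph) if there are integers $\lambda,\mu,\nu$ such that the number of walks of length $3$ from $x$ to $y$ is $\lambda$ if $x\neq y$ are adjacent, $\mu$ if $x\ne y$ are non-adjacent, and $\nu$ if $x=y$. *)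

(* Defs.v *)
From HB Require Import structures.
From mathcomp Require Import all_boot all_order all_fingroup all_algebra.

Set Implicit Arguments.
Unset Strict Implicit.
Unset Printing Implicit Defensive.

Import GRing.Theory.
Local Open Scope ring_scope.

Definition is_ideal (R : finComUnitRingType) (I : {set R}) : Prop :=
  [/\ 0 \in I,
      forall x y, x \in I -> y \in I -> x + y \in I
    & forall a x, x \in I -> a * x \in I].

Definition maximal_ideal (R : finComUnitRingType) (M : {set R}) : Prop :=
  [/\ is_ideal M, M != [set: R]
    & forall J : {set R}, is_ideal J -> M \subset J -> J = M \/ J = [set: R]].

Definition local_ring (R : finComUnitRingType) : Prop :=
  exists! M : {set R}, maximal_ideal M.

Definition finite_chain_ring (R : finComUnitRingType) : Prop :=
  local_ring R /\
  (forall I J : {set R}, is_ideal I -> is_ideal J -> I \subset J \/ J \subset I).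

Definition principal_ideal (R : finComUnitRingType) (a : R) : {set R} :=
  [set a * x | x : R].

Definition nilpotency_index (R : finComUnitRingType) (a : R) (r : nat) : Prop :=
  a ^+ r = 0 /\ (forall m, (m < r)%N -> a ^+ m != 0).

(* The residue field is F_q exactly when the quotient R / (gamma) has q
   elements, i.e. when (gamma) has index q in the additive group of R. *)
Definition chain_ring_parameters (R : finComUnitRingType) (gamma : R)
    (r q : nat) : Prop :=
  [/\ maximal_ideal (principal_ideal gamma), nilpotency_index gamma r
    & #|[set: R] : principal_ideal gamma|%g = q].

(* Only meant for r >= 2, since r - 2 is truncated. *)
Definition whom (R : finComUnitRingType) (gamma : R) (r q : nat) (x : R) : nat :=
  if x == 0 then 0%N
  else if x \in principal_ideal (gamma ^+ (r - 1)) then (q ^ (r - 1))%N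
  else ((q - 1) * q ^ (r - 2))%N.

Definition whom_vec (R : finComUnitRingType) (gamma : R) (r q n : nat)
    (c : 'cV[R]_n) : nat :=
  (\sum_(i < n) whom gamma r q (c i ord0))%N.

Definition dot (R : finComUnitRingType) (n : nat) (x y : 'cV[R]_n) : R :=
  \sum_(i < n) x i ord0 * y i ord0.

Definition regular_vectors (R : finComUnitRingType) (k : nat) : {set 'cV[R]_k} :=
  [set w | [set dot w x | x : 'cV[R]_k] == [set: R]].

Definition unit_stable (R : finComUnitRingType) (k : nat)
    (Omega : {set 'cV[R]_k}) : Prop :=
  forall (u : R) (w : 'cV[R]_k),
    u \is a GRing.unit -> w \in Omega -> u *: w \in Omega.

Definition generates (R : finComUnitRingType) (k : nat)
    (Omega : {set 'cV[R]_k}) : Prop :=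
  forall v : 'cV[R]_k,
    exists c : 'cV[R]_k -> R, v = \sum_(w in Omega) c w *: w.

(* For Omega made of regular vectors this forces n = |Omega| / |R^x|. *)
Definition unit_representatives (R : finComUnitRingType) (k n : nat)
    (Omega : {set 'cV[R]_k}) (H : 'M[R]_(k, n)) : Prop :=
  (forall j : 'I_n, col j H \in Omega) /\
  (forall w : 'cV[R]_k, w \in Omega ->
     exists! j : 'I_n, exists2 u : R, u \is a GRing.unit & w = u *: col j H).

Definition code (R : finComUnitRingType) (k n : nat) (H : 'M[R]_(k, n)) :
    {set 'cV[R]_n} :=
  [set x | H *m x == 0].

Definition dual_code (R : finComUnitRingType) (n : nat) (C : {set 'cV[R]_n}) :
    {set 'cV[R]_n} :=
  [set y | [forall x in C, dot x y == 0]].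

Definition is_homogeneous_weight (R : finComUnitRingType) (gamma : R)
    (r q n : nat) (C : {set 'cV[R]_n}) (w : nat) : Prop :=
  exists c : 'cV[R]_n, [/\ c \in C, c != 0 & whom_vec gamma r q c = w].

Definition triple_sum_set (R : finComUnitRingType) (k : nat)
    (Omega : {set 'cV[R]_k}) : Prop :=
  unit_stable Omega /\
  exists sigma0 sigma1 : int, forall h : 'cV[R]_k, h != 0 ->
    #|[set t : 'cV[R]_k * 'cV[R]_k * 'cV[R]_k |
        [&& t.1.1 \in Omega, t.1.2 \in Omega, t.2 \in Omega
          & h == t.1.1 + t.1.2 + t.2]]|%:Z
      = if h \in Omega then sigma0 else sigma1.

(* mult x y is the number of edges joining x to y; mult x x is the number of
   loops at x, each loop being traversable in one way only. *)
Record multigraph := Multigraph {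
  vertex : finType;
  mult : vertex -> vertex -> nat
}.

Definition adjacent (G : multigraph) (x y : vertex G) : bool :=
  (0 < mult x y)%N.

Fixpoint walks (G : multigraph) (l : nat) (x y : vertex G) : nat :=
  if l is l'.+1 then (\sum_(z : vertex G) mult x z * walks l' z y)%N
  else (x == y : nat).

Definition add_loops (G : multigraph) (b : nat) : multigraph :=
  @Multigraph (vertex G) (fun x y => mult x y + b * (x == y))%N.

Definition SWRG3 (G : multigraph) : Prop :=
  exists lambda mu nu : int, forall x y : vertex G,
    (walks 3 x y)%:Z =
      if x == y then nu else if adjacent x y then lambda else mu.

Definition syndromes (R : finComUnitRingType) (k n : nat) (H : 'M[R]_(k, n)) :
    {set 'cV[R]_k} :=
  [set H *m x | x : 'cV[R]_n].

Definition syndrome_graph (R : finComUnitRingType) (k n : nat)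
    (H : 'M[R]_(k, n)) : multigraph :=
  @Multigraph {s : 'cV[R]_k | s \in syndromes H}
    (fun s t => [exists j : 'I_n, exists u : R,
       (u \is a GRing.unit) && (val s - val t == u *: col j H)] : nat).

(* Main.v *)
Require Import Defs.
From HB Require Import structures.
From mathcomp Require Import all_boot all_order all_fingroup all_algebra.
From mathcomp Require Import all_field all_character.
From mathcomp Require Import ring zify.

Set Implicit Arguments.
Unset Strict Implicit.
Unset Printing Implicit Defensive.

Import GRing.Theory Num.Theory.
Local Open Scope ring_scope.

(** Fourier analysis on the finite group R^k turns counting into arithmetic of
    eigenvalues.  A finite chain ring has a generating character chi: an
    additive character that is trivial on no nonzero ideal.  It suffices that
    chi is nontrivial at gamma^(r-1), because every nonzero ideal contains this
    element ([exists_generating_char]).  The characters of R^k are then the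
    functions h |-> chi (a . h), for a in R^k, and their orthogonality gives
    Fourier inversion.

    The homogeneous weight is, up to an affine change, the sum of chi over the
    unit multiples of x:
      sum_(u unit) chi (u x) = (q-1) q^(r-1) - q w_hom(x)
    ([sum_char_units]).  The columns of H represent Omega modulo units and, being
    regular, have pairwise distinct unit multiples; so the eigenvalue of the
    Cayley graph of Omega at the character a is
      n (q-1) q^(r-1) - q w_hom(H^T a).
    Adding b loops, or for b = 1 adjoining 0 to Omega, adds b to it.  The words
    H^T a exhaust the dual code ([dual_code_code], a double annihilator theorem)
    and are nonzero for a nonzero, so that away from a = 0 there are exactly
    three distinct eigenvalues t1, t2, t3, one for each weight.

    All three properties say that F * F * F is constant on the nonzero elements
    of Omega and on those outside Omega, where F is the indicator of Omega plus
    b times that of 0.  In Fourier space this is the existence of c and p with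
    t^3 = c t + p for t = t1, t2, t3.  As these are distinct, X^3 - c X - p is
    then (X - t1) (X - t2) (X - t3), and such c and p exist exactly when
    t1 + t2 + t3 = 0; this is the stated condition on w1 + w2 + w3 ([conv3_two_valued],
    [conv3_edge_count_two_valued]). *)

(** * Additive characters of finite groups *)

Definition sub_closed (V : finZmodType) (I : {set V}) : Prop :=
  forall x y, x \in I -> y \in I -> x - y \in I.

Lemma card_additive (U V : finZmodType) (f : U -> V) (I : {set U}) :
    {morph f : x y / x - y} -> sub_closed I ->
  #|I| = (#|f @: I| * #|[set x in I | (f x == 0)%R]|)%N.
Proof.
move=> fB I_sub; rewrite -sum1_card (partition_big_imset f) /= -sum_nat_const.
apply: eq_bigr => _ /imsetP[x0 x0I ->].
(* The fibre through x0 is a translate of the kernel. *)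
rewrite sum1dep_card -(card_imset _ (addIr (- x0))).
apply: eq_card => y; rewrite inE; apply/imsetP/andP => [[x] | [yI fy]].
  by rewrite !inE => /andP[xI /eqP fx] ->; rewrite I_sub // fB fx subrr.
exists (y + x0); last by rewrite addrK.
have II : - x0 \in I by rewrite -sub0r I_sub // -(subrr x0) I_sub.
rewrite -[x0 in y + x0]opprK !inE I_sub //=.
by rewrite opprK -subr_eq0 -fB addrK fy.
Qed.

Definition additive_char (V : zmodType) (chi : V -> algC) : Prop :=
  chi 0 = 1 /\ {morph chi : x y / x + y >-> x * y}.

(** The condition says that no nonzero ideal lies in the kernel of chi; it is
    what makes R isomorphic to its character group as an R-module. *)
Definition generating_char (R : nzRingType) (chi : R -> algC) : Prop :=
  additive_char chi /\ forall x, x != 0 -> exists s, chi (s * x) != 1.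

(** The irreducible characters of a finite group have trivial common kernel, and
    those of an abelian group are linear. *)
Lemma exists_additive_char (V : finZmodType) (x : V) :
  x != 0 -> exists2 chi : V -> algC, additive_char chi & chi x != 1.
Proof.
move=> x_neq0; pose G := [set: V]%G.
have abG : abelian G by apply/centsP => y _ z _; apply: FinRing.zmod_mulgC.
have [i xi] : exists i : Iirr G, x \notin cfker 'chi_i.
  apply/existsP; rewrite -negb_forall; apply: contra x_neq0 => /forallP all_ker.
  have : x \in (\bigcap_(i : Iirr G) cfker 'chi_i)%g by apply/bigcapP => i _.
  by rewrite TI_cfker_irr inE.
have lin := char_abelianP _ abG i.
exists 'chi_i; first split.
- exact: (lin_char1 lin).
- by move=> y z; apply: (lin_charM lin); rewrite inE.
- by apply: contra xi => /eqP chix; rewrite cfkerEirr inE chix (lin_char1 lin).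
Qed.

(** Translating by x0 permutes I and multiplies the sum by chi x0. *)
Lemma sum_char_eq0 (V : finZmodType) (chi : V -> algC) (I : {set V}) (x0 : V) :
    additive_char chi -> sub_closed I -> x0 \in I -> chi x0 != 1 ->
  \sum_(x in I) chi x = 0.
Proof.
move=> [_ chiD] I_sub x0I chi_x0.
suff /eqP : (1 - chi x0) * \sum_(x in I) chi x = 0.
  by rewrite mulf_eq0 subr_eq0 eq_sym (negbTE chi_x0) => /eqP.
apply/eqP; rewrite mulrBl mul1r subr_eq0; apply/eqP.
have I0 : 0 \in I by rewrite -(subrr x0) I_sub.
rewrite [LHS](reindex_inj (addrI x0)) /= mulr_sumr.
apply: eq_big => [x|x _]; last exact: chiD.
apply/idP/idP => [h|xI]; first by rewrite -[x](addKr x0) addrC I_sub.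
by rewrite -[x]opprK I_sub // -sub0r I_sub.
Qed.

Lemma additive_char_mull (R : nzRingType) (chi : R -> algC) (x : R) :
  additive_char chi -> additive_char (fun t => chi (t * x)).
Proof. by case=> chi0 chiD; split=> [|s t]; rewrite ?mul0r // mulrDl chiD. Qed.

Lemma sum_char_ring (R : finNzRingType) (chi : R -> algC) (x : R) :
  generating_char chi -> \sum_(t : R) chi (t * x) = (#|R| * (x == 0))%:R.
Proof.
case=> chi_char gen; have [chi0 _] := chi_char.
have [->|/gen[s sx]] := eqVneq x 0.
  under eq_bigr do rewrite mulr0 chi0.
  by rewrite sumr_const muln1.
rewrite muln0 -[RHS](@sum_char_eq0 _ _ [set: R] s (additive_char_mull x chi_char)) //.
- by apply: eq_bigl => t; rewrite inE.
- by move=> y z _ _; rewrite inE.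
- by rewrite inE.
Qed.

(** * Finite chain rings and the homogeneous weight *)

Section ChainRing.

Lemma ideal_sub_closed (R : finComUnitRingType) (I : {set R}) :
  is_ideal I -> sub_closed I.
Proof. by case=> _ ID IM x y xI yI; apply: ID => //; rewrite -mulN1r IM. Qed.

Lemma principal_ideal_ideal (R : finComUnitRingType) (a : R) :
  is_ideal (principal_ideal a).
Proof.
split.
- by apply/imsetP; exists 0; rewrite ?mulr0.
- move=> _ _ /imsetP[x _ ->] /imsetP[y _ ->].
  by apply/imsetP; exists (x + y); rewrite ?mulrDr.
- move=> b _ /imsetP[x _ ->]; apply/imsetP; exists (b * x) => //.
  exact: mulrCA.
Qed.

Variables (R : finComUnitRingType) (gamma : R) (r q : nat).
Hypotheses (R_chain : finite_chain_ring R)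
  (R_param : chain_ring_parameters gamma r q).

Lemma mem_principal (a x : R) : a * x \in principal_ideal a.
Proof. by apply/imsetP; exists x. Qed.

(** The ideal of a nonunit x is comparable with the maximal ideal; if it
    contained the latter it would be equal to it or to R. *)
Lemma unit_notin_maximal (x : R) :
  (x \is a GRing.unit) = (x \notin principal_ideal gamma).
Proof.
have [[gI gT gmax] _ _] := R_param.
apply/idP/idP => [xU | xg].
  apply: contra gT => xg; rewrite eqEsubset subsetT; apply/subsetP => y _.
  have [_ _ IM] := gI; rewrite -[y](divrK xU); exact: IM.
have [_ /(_ _ _ (principal_ideal_ideal x) gI)[sub|sub]] := R_chain.
  by case/negP: xg; apply: (subsetP sub); rewrite -{1}[x]mulr1 mem_principal.
have [eq|eq] := gmax _ (principal_ideal_ideal x) sub.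
  by case/negP: xg; rewrite -eq -{1}[x]mulr1 mem_principal.
have : 1 \in principal_ideal x by rewrite eq inE.
by case/imsetP => y _ e; apply/unitrP; exists y; rewrite mulrC -e.
Qed.

(** A nonunit cofactor of gamma^i supplies a further factor gamma, which cannot
    go on for r steps. *)
Lemma chain_decomposition (x : R) :
  x != 0 -> exists i u, [/\ (i < r)%N, u \is a GRing.unit & x = gamma ^+ i * u].
Proof.
move=> x0; have [_ [gr _] _] := R_param.
have H i : (exists j u, [/\ (j < i)%N, u \is a GRing.unit & x = gamma ^+ j * u])
   \/ exists y, x = gamma ^+ i * y.
  elim: i => [|i [[j [u [ji uU e]]] | [y e]]].
  - by right; exists x; rewrite expr0 mul1r.
  - by left; exists j, u; split=> //; apply: ltnW.
  have [yU|] := boolP (y \is a GRing.unit); first by left; exists i, y.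
  rewrite unit_notin_maximal negbK => /imsetP[z _ ez].
  by right; exists z; rewrite e ez mulrA -exprSr.
have [//|[y e]] := H r.
by move: x0; rewrite e gr mul0r eqxx.
Qed.

Lemma nilpotency_index_gt0 : (0 < r)%N.
Proof.
have [_ [gr _] _] := R_param; rewrite lt0n; apply/eqP => r0.
by move: gr (oner_neq0 R); rewrite r0 expr0 => ->; rewrite eqxx.
Qed.

Lemma annihilator_maximal (x : R) :
  (gamma * x == 0) = (x \in principal_ideal (gamma ^+ (r - 1))).
Proof.
have [_ [gr gm] _] := R_param; have r_gt0 := nilpotency_index_gt0.
apply/idP/imsetP => [/eqP gx | [y _ ->]]; last first.
  by rewrite mulrA -exprS subn1 prednK // gr mul0r.
have [->|x0] := eqVneq x 0; first by exists 0; rewrite ?mulr0.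
have [i [u [ir uU e]]] := chain_decomposition x0.
have gi : gamma ^+ i.+1 = 0.
  by apply: (mulIr uU); rewrite mul0r exprS -mulrA -e.
have -> : (r - 1)%N = i.
  apply/eqP; rewrite subn1 -eqSS prednK // eqn_leq ir andbT leqNgt.
  by apply/negP => /gm; rewrite gi eqxx.
by exists u.
Qed.

Lemma socle_multiple (x : R) : x != 0 -> exists s, s * x = gamma ^+ (r - 1).
Proof.
move=> /chain_decomposition[i [u [ir uU ->]]].
exists (gamma ^+ (r - 1 - i) * u^-1).
rewrite mulrACA -exprD mulVr // mulr1 subnK //; lia.
Qed.

Lemma card_maximal_index : #|R| = (q * #|principal_ideal gamma|)%N.
Proof.
have [_ _ <-] := R_param.
have [I0 ID IM] := principal_ideal_ideal gamma.
have gP : group_set (principal_ideal gamma).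
  by apply/group_setP; split=> // x y; apply: ID.
by rewrite mulnC -cardsT; exact: esym (Lagrange (subsetT (Group gP))).
Qed.

(** Multiplication by gamma maps (gamma^i) onto (gamma^(i+1)), and for i < r its
    kernel there is the whole annihilator of gamma, of q elements by the case
    i = 0. *)
Lemma card_principal_power i :
  (i <= r)%N -> #|principal_ideal (gamma ^+ i)| = (q ^ (r - i))%N.
Proof.
have [_ [gr _] _] := R_param.
have cardS j : #|principal_ideal (gamma ^+ j)| =
   (#|principal_ideal (gamma ^+ j.+1)| *
    #|[set x in principal_ideal (gamma ^+ j) | (gamma * x == 0)%R]|)%N.
  rewrite (@card_additive _ _ ( *%R gamma) _ (mulrBr gamma)
    (ideal_sub_closed (principal_ideal_ideal (gamma ^+ j)))).
  congr (_ * _)%N; apply: eq_card => x.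
  apply/imsetP/imsetP => [[_ /imsetP[z _ ->] ->] | [z _ ->]].
    by exists z; rewrite // exprS mulrA.
  exists (gamma ^+ j * z); first exact: mem_principal.
  by rewrite exprS mulrA.
have card_ann j : (j < r)%N ->
  #|[set x in principal_ideal (gamma ^+ j) | (gamma * x == 0)%R]| =
  #|[set x | (gamma * x == 0)%R]|.
  move=> jr; apply: eq_card => x; rewrite !inE annihilator_maximal.
  apply: andb_idl => /imsetP[y _ ->].
  have -> : (r - 1 = j + (r - 1 - j))%N by lia.
  by rewrite exprD -mulrA mem_principal.
have ann_q : #|[set x | (gamma * x == 0)%R]| = q.
  have PT : principal_ideal (gamma ^+ 0) = [set: R].
    apply/setP => x; rewrite inE; apply/imsetP; exists x => //.
    by rewrite expr0 mul1r.
  have := cardS 0%N; rewrite PT cardsT card_maximal_index expr1 mulnC => /eqP.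
  rewrite eqn_pmul2l; last first.
    by apply/card_gt0P; exists 0; have [] := principal_ideal_ideal gamma.
  by move=> /eqP ->; apply: eq_card => x; rewrite !inE.
(* Downward induction on i, from the zero ideal (gamma^r). *)
move=> ir; have [d ->] : exists d, i = (r - d)%N.
  by exists (r - i)%N; rewrite subKn.
move: {i ir}d; elim=> [|d IHd].
  rewrite subn0 subnn gr expn0; apply/eqP/cards1P; exists 0.
  apply/setP => x; rewrite inE; apply/imsetP/eqP => [[y _ ->]|->].
    by rewrite mul0r.
  by exists 0; rewrite ?mul0r.
have [dr|rd] := ltnP d r; last first.
  have -> : (r - d.+1 = r - d)%N by lia.
  exact: IHd.
rewrite cardS card_ann ?ann_q; last by lia.
have -> : (r - d.+1).+1 = (r - d)%N by lia.
by rewrite IHd -expnSr; congr (q ^ _)%N; lia.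
Qed.

Lemma card_chain_ring : #|R| = (q ^ r)%N.
Proof.
rewrite -[r]subn0 -card_principal_power // expr0 -cardsT.
by apply: eq_card => x; rewrite inE; symmetry; apply/imsetP; exists x; rewrite ?mul1r.
Qed.

Lemma residue_gt0 : (0 < q)%N.
Proof.
have : (0 < #|R|)%N by apply/card_gt0P; exists 0.
by rewrite card_maximal_index muln_gt0 => /andP[].
Qed.

Lemma exists_generating_char : exists chi : R -> algC, generating_char chi.
Proof.
have [_ [_ gm] _] := R_param.
have /gm g_neq0 : (r - 1 < r)%N by have := nilpotency_index_gt0; lia.
have [chi chi_char chi_socle] := exists_additive_char g_neq0.
exists chi; split=> // x /socle_multiple[s sx].
by exists s; rewrite sx.
Qed.

Variable chi : R -> algC.
Hypothesis chi_gen : generating_char chi.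

Lemma sum_char_maximal (x : R) :
  \sum_(t in principal_ideal gamma) chi (t * x)
    = (#|principal_ideal gamma| * (gamma * x == 0))%:R.
Proof.
have [chi_char gen] := chi_gen; have [chi0 _] := chi_char.
have [gx|gx] := eqVneq (gamma * x) 0.
  rewrite muln1 -sumr_const; apply: eq_bigr => _ /imsetP[t _ ->].
  by rewrite mulrAC gx mul0r chi0.
have [s sx] := gen _ gx.
rewrite muln0 (@sum_char_eq0 _ _ _ (s * gamma) (additive_char_mull x chi_char)) //.
- exact: ideal_sub_closed (principal_ideal_ideal gamma).
- by rewrite mulrC mem_principal.
- by rewrite -mulrA.
Qed.

(** The units are the complement of the maximal ideal, and a sum of chi over the
    multiples of x by elements of an ideal I vanishes unless I x = 0.  The three
    values of the homogeneous weight are the three cases x = 0, gamma x = 0 with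
    x nonzero, and gamma x nonzero. *)
Lemma sum_char_units (x : R) : (2 <= r)%N ->
  \sum_(u : R | u \is a GRing.unit) chi (u * x)
    = (((q - 1) * q ^ (r - 1))%:Z - (q * whom gamma r q x)%:Z)%:~R.
Proof.
move=> r_ge2.
have -> : \sum_(u : R | u \is a GRing.unit) chi (u * x) =
   ((#|R| * (x == 0))%:Z - (#|principal_ideal gamma| * (gamma * x == 0)%R)%:Z)%:~R.
  rewrite intrB -!pmulrn -(sum_char_ring _ chi_gen) -sum_char_maximal.
  rewrite [in RHS](bigID (mem (principal_ideal gamma))) /= [X in X - _]addrC addrK.
  by apply: eq_bigl => u; rewrite unit_notin_maximal.
congr (_%:~R).
rewrite card_chain_ring -[gamma in principal_ideal gamma]expr1.
rewrite card_principal_power; last by lia.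
rewrite /whom annihilator_maximal.
have [s es] : exists s, r = s.+2 by exists (r - 2)%N; lia.
have -> : (r - 2 = s)%N by lia.
have -> : (r - 1 = s.+1)%N by lia.
rewrite es !expnS; have q0 := residue_gt0.
have [->|x0] := eqVneq x 0.
  have -> : (0 : R) \in principal_ideal (gamma ^+ s.+1).
    by have [] := principal_ideal_ideal (gamma ^+ s.+1).
  nia.
by case: (x \in _); nia.
Qed.

End ChainRing.

(** * Fourier analysis on R^k *)

Section Fourier.

Variables (R : finComUnitRingType) (chi : R -> algC).
Hypothesis chi_gen : generating_char chi.

Lemma dotE k (x y : 'cV[R]_k) : dot x y = (x^T *m y) 0 0.
Proof. by rewrite mxE; apply: eq_bigr => i _; rewrite mxE. Qed.

Lemma dotC k (x y : 'cV[R]_k) : dot x y = dot y x.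
Proof. by apply: eq_bigr => i _; rewrite mulrC. Qed.

Lemma dotDr k (x y z : 'cV[R]_k) : dot x (y + z) = dot x y + dot x z.
Proof. by rewrite !dotE mulmxDr mxE. Qed.

Lemma dotZr k s (x y : 'cV[R]_k) : dot x (s *: y) = s * dot x y.
Proof. by rewrite !dotE -scalemxAr mxE. Qed.

Lemma dot0r k (x : 'cV[R]_k) : dot x 0 = 0.
Proof. by rewrite dotE mulmx0 mxE. Qed.

Lemma dot_mulmxr k n (H : 'M[R]_(k, n)) a x :
  dot a (H *m x) = dot (H^T *m a) x.
Proof. by rewrite !dotE trmx_mul trmxK mulmxA. Qed.

Lemma dot_delta k (x : 'cV[R]_k) i : dot x (delta_mx i 0) = x i 0.
Proof.
rewrite /dot (bigD1 i) //= mxE !eqxx mulr1 big1 ?addr0 // => j /negPf ji.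
by rewrite mxE ji mulr0.
Qed.

Lemma char_dotD k (a : 'cV[R]_k) : additive_char (fun h => chi (dot a h)).
Proof.
have [[chi0 chiD] _] := chi_gen.
by split=> [|x y]; rewrite ?dot0r // dotDr chiD.
Qed.

Lemma sum_char_dot k (a : 'cV[R]_k) :
  \sum_h chi (dot a h) = (#|{: 'cV[R]_k}| * (a == 0))%:R.
Proof.
have [[chi0 chiD] gen] := chi_gen.
have [->|a0] := eqVneq a 0.
  under eq_bigr do rewrite dotC dot0r chi0.
  by rewrite sumr_const muln1.
have [i ai] : exists i, a i 0 != 0.
  apply/existsP; rewrite -negb_forall; apply: contra a0 => /forallP a0.
  by apply/eqP/matrixP => i j; rewrite ord1 mxE (eqP (a0 i)).
have [s sx] := gen _ ai.
rewrite muln0 -[RHS](@sum_char_eq0 _ _ [set: 'cV[R]_k] (s *: delta_mx i 0)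
  (char_dotD a)).
- by apply: eq_bigl => t; rewrite inE.
- by move=> y z _ _; rewrite inE.
- by rewrite inE.
- by rewrite dotZr dot_delta.
Qed.

Lemma card_cV_neq0 k : #|{: 'cV[R]_k}|%:R != 0 :> algC.
Proof. by rewrite pnatr_eq0 -lt0n; apply/card_gt0P; exists 0. Qed.

(** For y in the dual of the code, the double sum of chi ((H^T a + y) . x) over
    all a and x is computed in two ways.  Summing over a first leaves the words x
    of the code, each contributing the positive number |R^k|; summing over x
    first gives 0 unless H^T a = -y for some a. *)
Lemma dual_code_code k n (H : 'M[R]_(k, n)) :
  dual_code (code H) = [set H^T *m a | a : 'cV[R]_k].
Proof.
apply/setP => y; rewrite inE; apply/forall_inP/imsetP => [ydual|[a _ ->] x]; last first.
  by rewrite inE => /eqP Hx; rewrite dotC -dot_mulmxr Hx dot0r.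
have [[chi0 chiD] _] := chi_gen.
have [a /eqP Ha] : exists a : 'cV[R]_k, H^T *m a + y == 0.
  apply/existsP; rewrite -[[exists _, _]]negbK negb_exists; apply/negP => /forallP noa.
  have : \sum_(a : 'cV[R]_k) \sum_(x : 'cV[R]_n) chi (dot (H^T *m a + y) x) = 0.
    by rewrite big1 // => a _; rewrite sum_char_dot (negPf (noa a)) muln0.
  apply/eqP; rewrite exchange_big /=.
  have -> : \sum_(x : 'cV[R]_n) \sum_(a : 'cV[R]_k) chi (dot (H^T *m a + y) x)
     = #|code H|%:R * #|{: 'cV[R]_k}|%:R.
    rewrite mulr_natl -sumr_const [RHS]big_mkcond /=; apply: eq_bigr => x _.
    have -> : \sum_(a : 'cV[R]_k) chi (dot (H^T *m a + y) x) =
        chi (dot x y) * \sum_(a : 'cV[R]_k) chi (dot (H *m x) a).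
      rewrite mulr_sumr; apply: eq_bigr => a _.
      by rewrite dotC dotDr [dot x _]dotC -dot_mulmxr [dot a _]dotC addrC chiD.
    rewrite sum_char_dot; have := ydual x; rewrite inE.
    by case: eqP => _ H0; rewrite ?muln0 ?mulr0 // (eqP (H0 isT)) chi0 mul1r muln1.
  rewrite mulf_neq0 ?card_cV_neq0 // pnatr_eq0 -lt0n.
  by apply/card_gt0P; exists 0; rewrite inE mulmx0.
by exists (- a) => //; rewrite mulmxN -[y](addKr (H^T *m a)) Ha addr0.
Qed.

Definition fourier k (F : 'cV[R]_k -> algC) (a : 'cV[R]_k) : algC :=
  \sum_h F h * chi (dot a h).

(** Fourier inversion, when only the trivial character contributes. *)
Lemma fourier_constant k (F : 'cV[R]_k -> algC) :
  (forall a, a != 0 -> fourier F a = 0) -> forall g h, F g = F h.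
Proof.
move=> F0; have [[chi0 chiD] _] := chi_gen.
suff inv h : #|{: 'cV[R]_k}|%:R * F h = fourier F 0.
  by move=> g h; apply: (mulfI (card_cV_neq0 k)); rewrite !inv.
have -> : fourier F 0 = \sum_a fourier F a * chi (dot a (- h)).
  rewrite (bigD1 0) //= [dot 0 _]dotC dot0r chi0 mulr1.
  by rewrite big1 ?addr0 // => a a0; rewrite F0 ?mul0r.
under eq_bigr do rewrite mulr_suml.
rewrite exchange_big /= (bigD1 h) //= [X in _ + X]big1 ?addr0 => [|g gh].
  under eq_bigr do rewrite -mulrA -chiD -dotDr subrr dot0r chi0 mulr1.
  by rewrite sumr_const mulr_natl.
under eq_bigr do rewrite -mulrA -chiD -dotDr dotC.
by rewrite -mulr_sumr sum_char_dot subr_eq0 (negPf gh) muln0 mulr0.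
Qed.

Definition conv (V : finZmodType) (F G : V -> nat) (h : V) : nat :=
  \sum_x F x * G (h - x)%R.

Definition conv3 (V : finZmodType) (F : V -> nat) : V -> nat := conv F (conv F F).

Lemma fourier_conv k (F G : 'cV[R]_k -> nat) a :
  fourier (fun h => (conv F G h)%:R) a =
  fourier (fun h => (F h)%:R) a * fourier (fun h => (G h)%:R) a.
Proof.
have [[chi0 chiD] _] := chi_gen.
rewrite /fourier mulr_suml.
under eq_bigr do rewrite natr_sum mulr_suml.
rewrite exchange_big /=; apply: eq_bigr => x _.
rewrite (reindex_inj (addrI x)) /= mulr_sumr; apply: eq_bigr => y _.
by rewrite addrAC subrr add0r natrM dotDr chiD mulrACA.
Qed.

End Fourier.

(** * Two-valued triple convolutions *)

Definition two_valued_off_zero (V : nmodType) (P : pred V) (N : V -> nat) : Prop :=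
  exists sigma0 sigma1 : int, forall h, h != 0 ->
    (N h)%:Z = if P h then sigma0 else sigma1.

Section ThreeEigenvalues.

Variables (R : finComUnitRingType) (chi : R -> algC).
Hypothesis chi_gen : generating_char chi.

(** At a nontrivial character the Fourier transform of a constant is 0 and that
    of the indicator of 0 is 1; thus w is lost, which is the freedom in the
    constant sigma1. *)
Lemma fourier_affine k (F : 'cV[R]_k -> algC) (u v w : algC) a : a != 0 ->
  fourier chi (fun h => u * F h + v * (h == 0)%:R + w) a = u * fourier chi F a + v.
Proof.
move=> a0; have [[chi0 _] _] := chi_gen; rewrite /fourier.
under eq_bigr do rewrite !mulrDl -mulrA.
rewrite !big_split /= -!mulr_sumr sum_char_dot // (negPf a0) muln0 mulr0 addr0.
congr (_ + _); rewrite (bigD1 0) //= eqxx mulr1 dot0r chi0 mulr1.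
by rewrite big1 ?addr0 // => h /negPf ->; rewrite mulr0 mul0r.
Qed.

(** Dividing the difference of the equations of two roots u and v by u - v gives
    u^2 + u v + v^2 = c; subtracting two of these relations and dividing by
    t2 - t3 leaves the sum of the roots. *)
Lemma sum_eq0_of_common_cubic (t1 t2 t3 c p : int) :
    t1 != t2 -> t1 != t3 -> t2 != t3 ->
    {in [:: t1; t2; t3], forall z, z ^+ 3 = c * z + p} ->
  t1 + t2 + t3 = 0.
Proof.
move=> t12 t13 t23 cubic.
have quad u v : u != v -> u ^+ 3 = c * u + p -> v ^+ 3 = c * v + p ->
    u ^+ 2 + u * v + v ^+ 2 = c.
  move=> uv eu ev; apply: (mulfI (x := u - v)); first by rewrite subr_eq0.
  transitivity (u ^+ 3 - v ^+ 3); first by ring.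
  by rewrite eu ev; ring.
have [e1 e2 e3] : [/\ t1 ^+ 3 = c * t1 + p, t2 ^+ 3 = c * t2 + p
    & t3 ^+ 3 = c * t3 + p] by split; apply: cubic; rewrite !inE eqxx ?orbT.
apply: (mulfI (x := t2 - t3)); first by rewrite subr_eq0.
rewrite mulr0 -[RHS](subrr c) -{1}(quad _ _ t12 e1 e2) -(quad _ _ t13 e1 e3).
ring.
Qed.

(** Off zero, two-valuedness of the triple convolution means that it is an
    affine combination of F, of the indicator of 0 and of 1, which at the
    nontrivial characters says that all t satisfy one equation
    t^3 = c t + p. *)
Lemma conv3_two_valued k (F : 'cV[R]_k -> nat) (P : pred 'cV[R]_k)
    (t : 'cV[R]_k -> int) (t1 t2 t3 : int) :
    (forall h, h != 0 -> F h = P h) ->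
    (forall a, a != 0 -> fourier chi (fun h => (F h)%:R) a = (t a)%:~R) ->
    t1 != t2 -> t1 != t3 -> t2 != t3 ->
    (forall z, (exists2 a, a != 0 & t a = z) <-> z \in [:: t1; t2; t3]) ->
  two_valued_off_zero P (conv3 F)
  <-> t1 + t2 + t3 = 0.
Proof.
move=> FP Ft t12 t13 t23 t_values.
have cubeE a : a != 0 -> fourier chi (fun h => (conv3 F h)%:R) a = (t a ^+ 3)%:~R.
  by move=> a0; rewrite !fourier_conv // Ft // -!intrM !exprS expr0 mulr1.
split=> [[s0 [s1 conv3P]] | t_sum0].
  (* e is the coefficient of the indicator of 0, chosen so that the formula
     holds at h = 0, where nothing is assumed. *)
  pose e : int := (conv3 F 0)%:Z - s1 - (s0 - s1) * (F 0)%:Z.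
  apply: (@sum_eq0_of_common_cubic _ _ _ (s0 - s1) e) => // z.
  move=> /t_values[a a0 <-]; apply/eqP; rewrite -(eqr_int algC) -cubeE //.
  rewrite intrD intrM -(Ft a a0) -(fourier_affine _ _ _ s1%:~R a0).
  apply/eqP/eq_bigr => h _; congr (_ * _).
  rewrite [LHS]pmulrn [(F h)%:R]pmulrn [(h == 0)%:R]pmulrn -!intrM -!intrD.
  congr (_%:~R); have [->|h0] := eqVneq h 0; first by rewrite /e mulr1; ring.
  by rewrite conv3P // FP //; case: (P h); rewrite !mulr0 ?mulr1; ring.
(* The coefficients of (X - t1) (X - t2) (X - t3), with no X^2 term. *)
pose c : int := - (t1 * t2 + t1 * t3 + t2 * t3); pose p := t1 * t2 * t3.
have cubic a : a != 0 -> t a ^+ 3 = c * t a + p.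
  move=> a0; have : t a \in [:: t1; t2; t3] by apply/t_values; exists a.
  have t3E : t3 = - (t1 + t2).
    by apply/eqP; rewrite -addr_eq0 addrC t_sum0.
  rewrite !inE /c /p t3E.
  by case/or3P => /eqP ->; ring.
have const := @fourier_constant _ _ chi_gen k
  (fun h => (conv3 F h)%:R - c%:~R * (F h)%:R - p%:~R * (h == 0)%:R).
have {}const : forall g h, P g = P h -> g != 0 -> h != 0 -> conv3 F g = conv3 F h.
  move=> g h Pgh g0 h0; apply/eqP; rewrite -(eqr_nat algC); apply/eqP.
  have := const _ g h; rewrite (negPf g0) (negPf h0) !mulr0 !subr0 !FP // Pgh.
  move=> /(_ _)/addIr; apply=> a a0.
  transitivity (fourier chi (fun h => 1 * (conv3 F h)%:R + (- p%:~R) * (h == 0)%:R + 0) a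
    + fourier chi (fun h => (- c%:~R) * (F h)%:R + 0 * (h == 0)%:R + 0) a).
    rewrite -big_split /=; apply: eq_bigr => x _; ring.
  rewrite !fourier_affine // cubeE // Ft // cubic // intrD intrM; ring.
(* A class without nonzero elements puts no condition on its constant. *)
have value (b : bool) : exists s : int, forall h, h != 0 -> P h = b ->
    (conv3 F h)%:Z = s.
  have [g /andP[g0 /eqP Pg] | none] := pickP [pred g | (g != 0) && (P g == b)].
    by exists (conv3 F g) => h h0 Ph; rewrite (const _ g) // Pg.
  by exists 0 => h h0 Ph; have := none h; rewrite /= h0 Ph eqxx.
have [s0 s0P] := value true; have [s1 s1P] := value false.
exists s0, s1 => h h0.
by case Ph : (P h); [apply: s0P | apply: s1P].
Qed.

End ThreeEigenvalues.

(** * Triple sums and walks as convolutions *)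

Lemma card_triples (V : finZmodType) (S : {set V}) (h : V) :
  #|[set t : V * V * V | [&& t.1.1 \in S, t.1.2 \in S, t.2 \in S
      & (h == t.1.1 + t.1.2 + t.2)%R]]| = conv3 (fun x => x \in S) h.
Proof.
rewrite -sum1dep_card big_mkcond /=.
transitivity (\sum_x \sum_y \sum_z
    if [&& x \in S, y \in S, z \in S & (h == x + y + z)%R] then 1 else 0)%N.
  by rewrite !pair_bigA /=; apply: eq_bigr => -[[x y] z].
apply: eq_bigr => x _; rewrite /conv big_distrr /=; apply: eq_bigr => y _.
rewrite (bigD1 (h - x - y)) //= [X in (_ + X)%N]big1 ?addn0 => [|z z_neq].
  have -> : h == x + y + (h - x - y).
    by rewrite -[h - x - y]addrA -opprD [_ + (h - _)]addrC subrK.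
  by do 3 case: (_ \in S).
case: ifP => // /and4P[_ _ _ /eqP e]; case/eqP: z_neq.
by rewrite e -[_ - y]addrA -opprD addrAC subrr add0r.
Qed.

Lemma walks_cayley (V : finZmodType) (G : multigraph) (phi : vertex G -> V)
    (F : V -> nat) :
    bijective phi -> (forall x y, mult x y = F (phi x - phi y)) ->
  forall x y, walks 3 x y = conv3 F (phi x - phi y).
Proof.
move=> phi_bij multE x y.
have stepE (z z' : vertex G) (W : V -> nat) :
  (\sum_u mult z u * W (phi u - phi z')%R)%N = conv F W (phi z - phi z').
  have [psi phiK psiK] := phi_bij.
  rewrite /conv (reindex_inj (inv_inj (subKr (phi z)))) /=.
  rewrite (reindex phi) /=; last exact: onW_bij.
  apply: eq_bigr => u _; rewrite multE; congr (_ * W _)%N.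
  by rewrite opprB addrAC addrCA subrr addr0.
rewrite -[conv3 F _]stepE; apply: eq_bigr => u _; congr (_ * _)%N.
rewrite -stepE; apply: eq_bigr => v _; congr (_ * _)%N.
rewrite /walks (bigD1 y) //= eqxx muln1 big1 ?addn0 ?multE // => w /negPf ->.
by rewrite muln0.
Qed.

(** * The syndrome graph and its eigenvalues *)

Section SyndromeGraph.

Variables (R : finComUnitRingType) (gamma : R) (r q k n : nat).
Variables (Omega : {set 'cV[R]_k}) (H : 'M[R]_(k, n)).
Hypotheses (R_chain : finite_chain_ring R)
  (R_param : chain_ring_parameters gamma r q) (r_ge2 : (2 <= r)%N)
  (Omega_regular : Omega \subset regular_vectors R k)
  (Omega_stable : unit_stable Omega) (Omega_gen : generates Omega)
  (H_repr : unit_representatives Omega H).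

Lemma zero_notin_Omega : 0 \notin Omega.
Proof.
apply/negP => /(subsetP Omega_regular); rewrite inE => /eqP/setP/(_ 1).
rewrite inE => /imsetP[x _] /eqP.
by rewrite dotC dot0r oner_eq0.
Qed.

Lemma mem_Omega_col w :
  (w \in Omega) = [exists j, exists u : R, (u \is a GRing.unit) && (w == u *: col j H)].
Proof.
have [colO repr] := H_repr.
apply/idP/existsP => [/repr[j [[u uU ->] _]] | [j /existsP[u /andP[uU /eqP ->]]]].
  by exists j; apply/existsP; exists u; rewrite uU eqxx.
exact: Omega_stable.
Qed.

Lemma mul_trmx_eq0 (a : 'cV[R]_k) : (H^T *m a == 0) = (a == 0).
Proof.
apply/eqP/eqP => [Ha|->]; last by rewrite mulmx0.
have aO w : w \in Omega -> dot a w = 0.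
  rewrite mem_Omega_col => /existsP[j /existsP[u /andP[_ /eqP ->]]].
  by rewrite dotZr colE dot_mulmxr Ha dotC dot0r mulr0.
apply/matrixP => i j; rewrite ord1 mxE -dot_delta.
have [c ->] := Omega_gen (delta_mx i 0).
rewrite dotE mulmx_sumr summxE big1 // => w wO.
by rewrite -dotE dotZr aO // mulr0.
Qed.

Lemma syndromesT : syndromes H = [set: 'cV[R]_k].
Proof.
apply/setP => v; rewrite inE; apply/imsetP.
have [c ->] := Omega_gen v.
have colH w : w \in Omega -> exists x, w = H *m x.
  rewrite mem_Omega_col => /existsP[j /existsP[u /andP[_ /eqP ->]]].
  by exists (u *: delta_mx j 0); rewrite -scalemxAr -colE.
suff [x ->] : exists x, \sum_(w in Omega) c w *: w = H *m x by exists x.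
elim/big_rec: _ => [|w v' wO [x ->]]; first by exists 0; rewrite mulmx0.
have [y wy] := colH _ wO; exists (c w *: y + x).
by rewrite mulmxDr -scalemxAr -wy.
Qed.

(** Uniqueness of the representative recovers the column j from u *: col j H, and
    regularity of that column recovers u. *)
Lemma sum_Omega (T : nmodType) (F : 'cV[R]_k -> T) :
  \sum_(w in Omega) F w = \sum_j \sum_(u | u \is a GRing.unit) F (u *: col j H).
Proof.
have [colO repr] := H_repr.
rewrite pair_big_dep /=.
pose g (p : 'I_n * R) := p.2 *: col p.1 H.
have -> : Omega = g @: [set p | p.2 \is a GRing.unit].
  apply/setP => w; rewrite mem_Omega_col; apply/existsP/imsetP.
    by case=> j /existsP[u /andP[uU /eqP ->]]; exists (j, u); rewrite ?inE.
  case=> -[j u]; rewrite inE => /= uU ->.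
  by exists j; apply/existsP; exists u; rewrite uU eqxx.
rewrite big_imset /= => [|[j u] [j' u']].
  by apply: eq_bigl => p; rewrite inE.
rewrite !inE /g /= => uU uU' e.
have jj' : j = j'.
  have [i [_ i_uniq]] := repr _ (Omega_stable uU (colO j)).
  by rewrite -(i_uniq j) ?(i_uniq j') //; [exists u'; rewrite ?e | exists u].
move: e; rewrite -jj' => e; congr (_, _).
have := subsetP Omega_regular _ (colO j); rewrite inE => /eqP/setP/(_ 1).
rewrite inE => /imsetP[x _ jx].
by rewrite -[u]mulr1 -[u']mulr1 jx ![dot (col j H) x]dotC -!dotZr e.
Qed.

(** The number of edges from x to x - h in the syndrome graph with b loops; for
    b = 0 and b = 1 also the indicator functions of Omega and of 0 |: Omega. *)
Definition edge_count (b : nat) (h : 'cV[R]_k) : nat := (h \in Omega) + b * (h == 0).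

(** For b = 0 the value at w = 0 is |Omega|, the valency. *)
Definition eigenvalue_of_weight (b w : nat) : int :=
  (b + n * (q - 1) * q ^ (r - 1))%:Z - (q * w)%:Z.

(** The eigenvalues of the graph: the transform of the indicator of Omega is a
    sum of [sum_char_units] over the coordinates of H^T a, and that of b times
    the indicator of 0 is b. *)
Lemma fourier_edge_count (chi : R -> algC) b (a : 'cV[R]_k) : generating_char chi ->
  fourier chi (fun h => (edge_count b h)%:R) a
    = (eigenvalue_of_weight b (whom_vec gamma r q (H^T *m a)))%:~R.
Proof.
move=> chi_gen; have [[chi0 _] _] := chi_gen.
rewrite /fourier /edge_count.
under eq_bigr do rewrite natrD mulrDl.
rewrite big_split /= [X in _ + X](bigD1 0) //= eqxx muln1 dot0r chi0 mulr1.
rewrite [X in _ + (_ + X)]big1 ?addr0; last by move=> h /negPf ->; rewrite muln0 mul0r.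
have -> : \sum_h (h \in Omega)%:R * chi (dot a h) = \sum_(w in Omega) chi (dot a w).
  rewrite [RHS]big_mkcond /=; apply: eq_bigr => h _.
  by case: (h \in Omega); rewrite ?mul1r ?mul0r.
rewrite sum_Omega.
under eq_bigr => j _.
  under eq_bigr do rewrite dotZr colE dot_mulmxr dot_delta.
  rewrite (sum_char_units R_chain R_param chi_gen _ r_ge2).
  over.
rewrite -rmorph_sum /= pmulrn -intrD; congr (_%:~R).
rewrite sumrB /= sumr_const card_ord /eigenvalue_of_weight /whom_vec big_distrr /=.
rewrite PoszD addrC addrA; congr (_ + _ - _); last by rewrite (big_morph _ PoszD (erefl 0%:Z)).
by rewrite -mulr_natr natz -PoszM mulnC mulnA.
Qed.

Lemma dual_code_weights (w : nat) :
  is_homogeneous_weight gamma r q (dual_code (code H)) w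
  <-> exists2 a : 'cV[R]_k, a != 0 & whom_vec gamma r q (H^T *m a) = w.
Proof.
have [chi chi_gen] := exists_generating_char R_chain R_param.
rewrite /is_homogeneous_weight (dual_code_code chi_gen).
split=> [[c [/imsetP[a _ ->] a0 <-]] | [a a0 <-]].
  by exists a; rewrite -?mul_trmx_eq0.
by exists (H^T *m a); rewrite mul_trmx_eq0 imset_f.
Qed.

(** The equation on the right is the vanishing of the sum of the three
    eigenvalues, cleared of subtraction. *)
Lemma conv3_edge_count_two_valued (b w1 w2 w3 : nat) :
    (w1 < w2)%N -> (w2 < w3)%N ->
    (forall w, is_homogeneous_weight gamma r q (dual_code (code H)) w
       <-> w \in [:: w1; w2; w3]) ->
  two_valued_off_zero (fun h => h \in Omega) (conv3 (edge_count b))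
  <-> (q * (w1 + w2 + w3) = 3 * (b + n * (q - 1) * q ^ (r - 1)))%N.
Proof.
move=> w12 w23 three_weights.
have [chi chi_gen] := exists_generating_char R_chain R_param.
have q_gt0 := residue_gt0 R_param.
have eig_inj : injective (eigenvalue_of_weight b).
  move=> v w; rewrite /eigenvalue_of_weight => e.
  by apply/eqP; rewrite -(eqn_pmul2l q_gt0); apply/eqP; lia.
rewrite (@conv3_two_valued _ _ chi_gen _ _ (fun h => h \in Omega)
  (fun a => eigenvalue_of_weight b (whom_vec gamma r q (H^T *m a)))
  (eigenvalue_of_weight b w1) (eigenvalue_of_weight b w2)
  (eigenvalue_of_weight b w3)).
- rewrite /eigenvalue_of_weight; lia.
- by move=> h /negPf h0; rewrite /edge_count h0 muln0 addn0.
- by move=> a _; apply: fourier_edge_count.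
- by rewrite (inj_eq eig_inj); lia.
- by rewrite (inj_eq eig_inj); lia.
- by rewrite (inj_eq eig_inj); lia.
- move=> z; split=> [[a a0 <-] | ].
    rewrite !inE !(inj_eq eig_inj).
    have /three_weights : is_homogeneous_weight gamma r q (dual_code (code H))
        (whom_vec gamma r q (H^T *m a)) by apply/dual_code_weights; exists a.
    by rewrite !inE.
  have attained w : w \in [:: w1; w2; w3] -> exists2 a, a != 0 &
      eigenvalue_of_weight b (whom_vec gamma r q (H^T *m a)) = eigenvalue_of_weight b w.
    by move=> /three_weights/dual_code_weights[a a0 <-]; exists a.
  by rewrite !inE => /or3P[] /eqP ->; apply: attained; rewrite !inE eqxx ?orbT.
Qed.

Lemma triple_sum_set_conv3 (S : {set 'cV[R]_k}) b :
    unit_stable S -> (forall x, (x \in S : nat) = edge_count b x) ->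
  triple_sum_set S <->
  two_valued_off_zero (fun h => h \in Omega) (conv3 (edge_count b)).
Proof.
move=> S_stable SE.
have memS h : h != 0 -> (h \in S) = (h \in Omega).
  by move=> /negPf h0; have := SE h; rewrite /edge_count h0 muln0 addn0; do 2 case: (h \in _).
have convE h : conv3 (fun x => x \in S) h = conv3 (edge_count b) h.
  rewrite /conv3 /conv; apply: eq_bigr => x _; rewrite SE; congr (_ * _)%N.
  by apply: eq_bigr => y _; rewrite !SE.
split=> [[_ [s0 [s1 sP]]] | [s0 [s1 sP]]]; last split=> //; exists s0, s1 => h h0.
  by rewrite -memS // -sP // card_triples convE.
by rewrite memS // -sP // card_triples convE.
Qed.

(** The number of closed walks does not depend on the vertex of a Cayley graph,
    so the constant nu is free; loops do not affect adjacency of distinct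
    vertices. *)
Lemma SWRG3_conv3 b :
  SWRG3 (add_loops (syndrome_graph H) b) <->
  two_valued_off_zero (fun h => h \in Omega) (conv3 (edge_count b)).
Proof.
set G := add_loops _ b.
pose phi : vertex G -> 'cV[R]_k := val.
have inS (h : 'cV[R]_k) : h \in syndromes H by rewrite syndromesT inE.
pose psi h : vertex G := Sub h (inS h).
have psiK : cancel psi phi by move=> h; apply: SubK.
have phi_bij : bijective phi by exists psi => // x; apply: val_inj; apply: psiK.
have multE (x y : vertex G) : mult x y = edge_count b (phi x - phi y).
  by rewrite /edge_count mem_Omega_col subr_eq0 /phi (inj_eq val_inj).
have adjE (x y : vertex G) : x != y -> adjacent x y = (phi x - phi y \in Omega).
  move=> /negPf xy; rewrite /adjacent multE /edge_count subr_eq0.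
  by rewrite (inj_eq val_inj) xy muln0 addn0 lt0b.
have walksE := walks_cayley phi_bij multE.
split=> [[l [m [v lmv]]] | [s0 [s1 sP]]].
  exists l, m => h h0; have := lmv (psi h) (psi 0).
  have neq : psi h != psi 0 by apply: contra h0 => /eqP/(congr1 phi); rewrite !psiK => ->.
  by rewrite walksE (negPf neq) adjE // !psiK subr0.
exists s0, s1, (conv3 (edge_count b) 0)%:Z => x y; rewrite walksE.
have [->|xy] := eqVneq x y; first by rewrite subrr.
by rewrite adjE // sP // subr_eq0 (inj_eq val_inj).
Qed.

End SyndromeGraph.

Theorem theorem12 (R : finComUnitRingType) (gamma : R) (r q k n : nat)
    (Omega : {set 'cV[R]_k}) (H : 'M[R]_(k, n)) (w1 w2 w3 b : nat)
    (R_chain : finite_chain_ring R)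
    (R_param : chain_ring_parameters gamma r q)
    (r_ge2 : (2 <= r)%N)
    (Omega_regular : Omega \subset regular_vectors R k)
    (Omega_stable : unit_stable Omega)
    (Omega_gen : generates Omega)
    (H_repr : unit_representatives Omega H)
    (w12 : (w1 < w2)%N) (w23 : (w2 < w3)%N)
    (three_weights : forall w : nat,
       is_homogeneous_weight gamma r q (dual_code (code H)) w
         <-> w \in [:: w1; w2; w3]) :
  [/\ triple_sum_set Omega
        <-> (w1 + w2 + w3)%N = (3 * n * (q - 1) * q ^ (r - 2))%N,
      triple_sum_set (0 |: Omega)
        <-> (w1 + w2 + w3)%:R
            = 3%:R * ((1 + n * (q - 1) * q ^ (r - 1))%:R / q%:R) :> rat
    & SWRG3 (add_loops (syndrome_graph H) b)
        <-> (w1 + w2 + w3)%:R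
            = 3%:R * ((b + n * (q - 1) * q ^ (r - 1))%:R / q%:R) :> rat].
Proof.
have q_gt0 := residue_gt0 R_param.
have criterion b' := conv3_edge_count_two_valued R_chain R_param r_ge2
  Omega_regular Omega_stable Omega_gen H_repr b' w12 w23 three_weights.
have ratE (w m : nat) : (w%:R = 3%:R * (m%:R / q%:R) :> rat) <-> (q * w = 3 * m)%N.
  have q0 : (q%:R : rat) != 0 by rewrite pnatr_eq0 -lt0n.
  rewrite mulrA; split=> [/(canLR (divfK q0)) | /(congr1 (fun m => m%:R : rat))].
    by rewrite -!natrM mulnC => /eqP; rewrite eqr_nat => /eqP.
  by rewrite mulnC !natrM => /(canRL (mulfK q0)).
have O0 := zero_notin_Omega Omega_regular.
split.
- rewrite (triple_sum_set_conv3 (Omega := Omega) (b := 0) Omega_stable) => [|x].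
    have -> : (3 * n * (q - 1) * q ^ (r - 2) = 3 * (n * (q - 1) * q ^ (r - 2)))%N.
      by rewrite !mulnA.
    rewrite criterion add0n; have -> : (r - 1 = (r - 2).+1)%N by lia.
    rewrite expnS; split=> [e | ->]; last by ring.
    by apply/eqP; rewrite -(eqn_pmul2l q_gt0) e; apply/eqP; ring.
  by rewrite /edge_count mul0n addn0.
- rewrite ratE -criterion; apply: triple_sum_set_conv3 => [u w uU|x].
    rewrite !inE => /orP[/eqP->|wO]; first by rewrite scaler0 eqxx.
    by rewrite (Omega_stable _ _ uU wO) orbT.
  rewrite /edge_count !inE mul1n.
  by have [->|] := eqVneq x 0; [rewrite (negPf O0) | rewrite addn0].
- by rewrite ratE -criterion; apply: SWRG3_conv3.
Qed.
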